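(* Let $S$ be a numerical semigroup of maximal embedding dimension generated by an arithmetic sequence, and let $m$ be a positive integer. Then $S=\langle \{a+id: 0\le i\le a-1\}\rangle$ for integers $a\ge1$ and $d\ge1$ with $\gcd(a,d)=1$ (where, if $a=1$, one takes $d=1$). Moreover, $\mathrm{H}(S)$ is equidistributed modulo $m$ if and only if $\gcd(ad,m)=1$ and at least one of the following occurs: (1) $a\equiv1\pmod m$; or (2) $d\equiv-1\pmod m$.
   Context: A numerical semigroup is a submonoid $S$ of $(\mathbb{N}_0,+)$ with finite complement; $\mathrm{H}(S)=\mathbb{N}_0\setminus S$ is its set of gaps. For $G\subset\mathbb{N}_0$, $\langle G\rangle$ is the set of all finite $\mathbb{N}_0$-linear combinations of elements of $G$. The embedding dimension of $S$ is the cardinality of its unique minimal generating set, the multiplicity of $S$ is its least nonzero element, and $S$ has maximal embedding dimension if these two numbers are equal. ''Generated by an arithmetic sequence'' means that the minimal generating set is of the form $\{a,a+d,a+2d,\dots,a+kd\}$ with $d\ge1$. A finite (multi)set of integers is equidistributed modulo $m$ if it contains the same number of elements in each congruence class modulo $m$. *)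

(* Defs.v *)
From mathcomp Require Import all_boot all_order all_algebra.
From mathcomp Require Import all_classical.

Set Implicit Arguments.
Unset Strict Implicit.
Unset Printing Implicit Defensive.

Local Open Scope classical_set_scope.
Local Open Scope card_scope.

Definition numerical_semigroup (S : set nat) : Prop :=
  [/\ S 0, (forall x y, S x -> S y -> S (x + y)) & finite_set (~` S)].

Definition gaps (S : set nat) : set nat := ~` S.

Definition generated (G : set nat) : set nat :=
  [set n | exists (s : seq nat) (c : nat -> nat),
      [set` s] `<=` G /\ n = \sum_(x <- s) c x * x].

Definition minimal_generating_set (S G : set nat) : Prop :=
  generated G = S /\ forall G', G' `<=` G -> generated G' = S -> G' = G.

(* The embedding dimension and the multiplicity are given as functional
   relations. A numerical semigroup has exactly one minimal generating set, so
   the existential over G ranges over that set only. *)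
Definition embedding_dimension (S : set nat) (e : nat) : Prop :=
  exists2 G, minimal_generating_set S G & G #= `I_e.

Definition multiplicity (S : set nat) (a : nat) : Prop :=
  [/\ S a, 0 < a & forall b, S b -> 0 < b -> a <= b].

Definition maximal_embedding_dimension (S : set nat) : Prop :=
  exists2 a, multiplicity S a & embedding_dimension S a.

(* {a, a + d, ..., a + k d}: k + 1 terms *)
Definition arithmetic_sequence (a d k : nat) : set nat :=
  [set a + i * d | i in [set i | i <= k]].

Definition generated_by_arithmetic_sequence (S : set nat) : Prop :=
  exists a d k, 0 < d /\ minimal_generating_set S (arithmetic_sequence a d k).

(* Meaningful for finite A, where #= compares numbers of elements. *)
Definition equidistributed (A : set nat) (m : nat) : Prop :=
  forall i j : nat,
    A `&` [set x | x = i %[mod m]] #= A `&` [set x | x = j %[mod m]].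

(* For a = 1 every d gives the semigroup of all naturals; the last conjunct
   fixes d = 1 in that case. *)
Definition standard_presentation (S : set nat) (a d : nat) : Prop :=
  [/\ 0 < a, 0 < d, coprime a d,
      S = generated (arithmetic_sequence a d a.-1) & (a = 1 -> d = 1)].

(* Main.v *)
Require Import Defs.
From mathcomp Require Import all_boot all_order all_algebra all_field.
From mathcomp Require Import all_classical.
From mathcomp Require Import ring zify.

(* Let H(X) be the sum of X^g over the gaps g. The gaps are equidistributed
   modulo m iff H(z) = 0 for every m-th root of unity z <> 1. The elements
   a + i d with 0 < i < a are the nonzero Apery elements of S with respect to a,
   which gives
     (X - 1) (X^a - 1) (X^d - 1) H(X) = P(X),
     P(X) = X^(ad+a+1) - X^(ad+a) - X^(a+d+1) + X^a + X^(d+1) - X.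
   If H(z) = 0 and z^a = 1 or z^d = 1, then z is a double root of P, and P'(z) = 0
   reads w^(k+1) = (k+1) w - k with w = z or w = 1/z, which forces z = 1; so
   equidistribution implies gcd(ad, m) = 1. At a primitive m-th root z, P(z) = 0
   says that the triples with exponents (ad+a, a-1, d) and (ad+a-1, a+d, 0) have
   equal sums; their products agree as well, so by complex conjugation all their
   symmetric functions agree and ad+a is congruent to ad+a-1, a+d or 0. *)

(** * Roots of unity and the six-term polynomial P *)

Section RootsOfUnity.
Import Order.TTheory GRing.Theory Num.Theory.
Local Open Scope ring_scope.

Lemma root_unity_conj (m : nat) (z : algC) :
  (0 < m)%N -> z ^+ m = 1 -> z * z^* = 1.
Proof.
move=> m_gt0 zm.
have /eqP : `|z| ^+ m = 1 by rewrite -normrX zm normr1.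
by rewrite pexpr_eq1 // => /eqP z1; rewrite -normCK z1 expr1n.
Qed.

(* The equation says (k+1) z - k = z^(k+1), whose squared modulus is
   1 + 2 k (k+1) (1 - Re z). *)
Lemma root_unity_eq1 (k m : nat) (z : algC) :
  (0 < m)%N -> (0 < k)%N -> z ^+ m = 1 ->
  z ^+ k.+1 - k.+1%:R * z + k%:R = 0 -> z = 1.
Proof.
move=> m_gt0 k_gt0 zm E.
have zw := root_unity_conj m z m_gt0 zm; set w := z^* in zw.
have Ez : z ^+ k.+1 = k.+1%:R * z - k%:R.
  by apply/eqP; rewrite -subr_eq0 -E; apply/eqP; ring.
have Ew : w ^+ k.+1 = k.+1%:R * w - k%:R.
  by rewrite /w -rmorphXn Ez rmorphB rmorphM !rmorph_nat.
have : z ^+ k.+1 * w ^+ k.+1 = 1 by rewrite -exprMn zw expr1n.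
rewrite Ez Ew => H.
have : k.+1%:R * k%:R * (z - 1) ^+ 2 = 0.
  (* The identity holds with k + 1 and k as independent quantities. The three summands vanish by
     [H], by z w = 1 and by (k + 1) - k = 1. *)
  have -> : k.+1%:R * k%:R * (z - 1) ^+ 2 =
    z * (1 - (k.+1%:R * z - k%:R) * (k.+1%:R * w - k%:R))
     + (k.+1%:R ^+ 2 * z - k.+1%:R * k%:R) * (z * w - 1)
     + z * (k.+1%:R - k%:R - 1) * (k.+1%:R - k%:R + 1).
    ring.
  by rewrite H zw -natr1; ring.
move/eqP; rewrite !mulf_eq0 !pnatr_eq0 /= (gtn_eqF k_gt0) /= orbb subr_eq0.
by move/eqP.
Qed.

(** On the unit circle conjugation is inversion, so the second symmetric function is the third times
    the conjugate of the first. Hence x1 is a root of the cubic with roots y1, y2, y3. *)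
Lemma unimodular_triples (x1 x2 x3 y1 y2 y3 : algC) :
  x1 * x1^* = 1 -> x2 * x2^* = 1 -> x3 * x3^* = 1 ->
  y1 * y1^* = 1 -> y2 * y2^* = 1 -> y3 * y3^* = 1 ->
  x1 + x2 + x3 = y1 + y2 + y3 -> x1 * x2 * x3 = y1 * y2 * y3 ->
  [\/ x1 = y1, x1 = y2 | x1 = y3].
Proof.
move=> u1 u2 u3 v1 v2 v3 e1 e3.
have e1' : x1^* + x2^* + x3^* = y1^* + y2^* + y3^* by rewrite -!rmorphD e1.
have e2 : x1 * x2 + x1 * x3 + x2 * x3 = y1 * y2 + y1 * y3 + y2 * y3.
  have -> : x1 * x2 + x1 * x3 + x2 * x3 = x1 * x2 * x3 * (x1^* + x2^* + x3^*).
    transitivity (x1 * x2 * (x3 * x3^*) + x1 * x3 * (x2 * x2^*) + x2 * x3 * (x1 * x1^*)).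
      by rewrite u1 u2 u3 !mulr1.
    ring.
  rewrite e1' e3.
  transitivity (y1 * y2 * (y3 * y3^*) + y1 * y3 * (y2 * y2^*) + y2 * y3 * (y1 * y1^*)).
    ring.
  by rewrite v1 v2 v3 !mulr1.
have : (x1 - y1) * (x1 - y2) * (x1 - y3) = 0.
  transitivity (x1 ^+ 3 - (y1 + y2 + y3) * x1 ^+ 2
     + (y1 * y2 + y1 * y3 + y2 * y3) * x1 - y1 * y2 * y3); first ring.
  rewrite -e1 -e2 -e3; ring.
move/eqP; rewrite !mulf_eq0 !subr_eq0.
by case/orP=> [/orP[]|] /eqP; [constructor 1 | constructor 2 | constructor 3].
Qed.

Lemma nth_root_primitive_trivial (n : nat) :
  (0 < n)%N -> (forall z : algC, z ^+ n = 1 -> z = 1) -> n = 1%N.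
Proof.
move=> n_gt0 H; have [z pz] := C_prim_root_exists n_gt0.
have z1 := H z (prim_expr_order pz).
have : (n %| 1)%N by rewrite (prim_order_dvd pz) z1 expr1n.
by rewrite dvdn1 => /eqP.
Qed.

Definition six_terms (a d : nat) : {poly algC} :=
  'X^(a * d + a + 1) - 'X^(a * d + a) - 'X^(a + d + 1) + 'X^a
  + 'X^(d + 1) - 'X.

(** The factor z restores each exponent that differentiation lowers, so z^a = 1 or z^d = 1 can be
    substituted directly. *)
Lemma six_terms_deriv (a d : nat) (z : algC) :
  z * (six_terms a d)^`().[z] =
  (a * d + a + 1)%:R * z ^+ (a * d + a + 1) - (a * d + a)%:R * z ^+ (a * d + a)
  - (a + d + 1)%:R * z ^+ (a + d + 1) + a%:R * z ^+ a
  + (d + 1)%:R * z ^+ (d + 1) - z.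
Proof.
have D n : z * ('X^n : {poly algC})^`().[z] = n%:R * z ^+ n.
  rewrite derivXn hornerMn hornerXn -mulr_natl mulrCA.
  by case: n => [|n]; rewrite ?mul0r // exprS.
rewrite /six_terms !(derivD, derivN) !(hornerD, hornerN) !mulrDr !mulrN !D.
by rewrite derivX hornerC mulr1.
Qed.

Lemma six_terms_eval (a d : nat) (z : algC) :
  (six_terms a d).[z] = z ^+ (a * d + a + 1) - z ^+ (a * d + a)
  - z ^+ (a + d + 1) + z ^+ a + z ^+ (d + 1) - z.
Proof. by rewrite /six_terms !hornerE. Qed.

Lemma six_terms_no_root (a d m : nat) (z : algC) (H : {poly algC}) :
  (0 < m)%N -> (0 < a)%N -> (0 < d)%N -> (a = 1 -> d = 1)%N ->
  ('X - 1) * ('X^a - 1) * ('X^d - 1) * H = six_terms a d ->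
  z ^+ m = 1 -> H.[z] = 0 -> (z ^+ a == 1) || (z ^+ d == 1) -> z = 1.
Proof.
move=> m_gt0 a_gt0 d_gt0 ad1 E zm Hz za.
(* Both H and the product of the three binomials vanish at z. *)
have D : (six_terms a d)^`().[z] = 0.
  rewrite -E derivM hornerD !hornerM Hz mulr0 add0r.
  rewrite !hornerE.
  by case/orP: za => /eqP ->; rewrite subrr ?mulr0 ?mul0r.
have := six_terms_deriv a d z; rewrite D mulr0 !exprD exprM !natrD natrM expr1.
case/orP: za => /eqP za; rewrite za.
  (* For z^a = 1, z P'(z) = - a (z^(d+1) - (d+1) z + d). *)
  rewrite expr1n => D'; apply: (root_unity_eq1 d m) => //.
  have : a%:R * (z ^+ d.+1 - d.+1%:R * z + d%:R) = 0.
    by rewrite exprSr -natr1 -[RHS]oppr0 [in RHS]D'; ring.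
  by move/eqP; rewrite mulf_eq0 pnatr_eq0 (gtn_eqF a_gt0) => /eqP.
(* For z^d = 1 the relation is used with k = a - 1, which must be positive; if a = 1, then d = 1 and
   z = z^d. *)
have [a1|a_neq1] := eqVneq a 1%N; first by rewrite -za (ad1 a1) expr1.
rewrite -exprM mulnC exprM za expr1n => D'.
have zU : z \is a GRing.unit.
  rewrite unitfE; apply: contra_eq_neq zm => ->.
  by rewrite expr0n gtn_eqF // eq_sym oner_eq0.
suff : z^-1 = 1 by move/(congr1 GRing.inv); rewrite invrK invr1.
apply: (root_unity_eq1 a.-1 m) => //; first lia.
  by rewrite exprVn zm invr1.
rewrite prednK // exprVn.
have zaU : z ^+ a \is a GRing.unit by rewrite unitrX.
have -> : a.-1%:R = a%:R - 1 :> algC by rewrite -subn1 natrB.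
(* Dividing the bracket by z^(a+1) gives the relation for 1/z. *)
have : d%:R * ((a%:R - 1) * z ^+ a * z - a%:R * z ^+ a + z) = 0.
  by rewrite [RHS]D'; ring.
move/eqP; rewrite mulf_eq0 pnatr_eq0 (gtn_eqF d_gt0) /= => /eqP K.
apply: (mulIr zaU); apply: (mulIr zU); rewrite mul0r mul0r -[RHS]K.
field.
by rewrite -unitfE zU -unitfE.
Qed.
End RootsOfUnity.

(** * Equidistribution as vanishing at roots of unity *)

Section GeneratingPolynomial.
Import Order.TTheory GRing.Theory Num.Theory.
Local Open Scope classical_set_scope.
Local Open Scope card_scope.
Local Open Scope ring_scope.

Lemma card_eq_seq (s : seq nat) : uniq s -> [set` s] #= `I_(size s).
Proof.
move=> us; rewrite card_eq_sym; apply/card_set_bijP; exists (nth 0%N s); split.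
- by move=> i /= i_lt; apply: mem_nth.
- move=> i j; rewrite !inE /= => i_lt j_lt E.
  by apply/eqP; rewrite -(nth_uniq 0%N i_lt j_lt us) E.
- move=> x /= xs; exists (index x s); first by rewrite /= index_mem.
  exact: nth_index.
Qed.

Lemma equidistributed_seqP (L : seq nat) (m : nat) : uniq L ->
  equidistributed [set` L] m <->
  forall i j, count (fun x => x == i %[mod m]) L = count (fun x => x == j %[mod m]) L.
Proof.
move=> uL.
have E i : [set` L] `&` [set x | x = i %[mod m]]
    #= `I_(count (fun x => x == i %[mod m]) L).
  rewrite -size_filter.
  have -> : [set` L] `&` [set x | x = i %[mod m]]
          = [set` [seq x <- L | x == i %[mod m]]].
    apply/seteqP; split=> x /=; rewrite mem_filter.
      by case=> -> ->; rewrite eqxx.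
    by case/andP=> /eqP.
  exact/card_eq_seq/filter_uniq.
split=> H i j.
  by apply/card_eq_II; rewrite -(card_eql (E i)) -(card_eqr (E j)); exact: H.
by rewrite (card_eql (E i)) (card_eqr (E j)) (H i j) card_eqxx.
Qed.

Definition gen_poly (L : seq nat) : {poly algC} := \sum_(x <- L) 'X^x.

(** Powers of z depend only on the exponent modulo m: the values at m-th roots of unity are the
    discrete Fourier transform of the residue counts. *)
Lemma gen_poly_residues (L : seq nat) (m : nat) (z : algC) :
  (0 < m)%N -> z ^+ m = 1 ->
  (gen_poly L).[z] = \sum_(r < m) (count (fun x => x == r %[mod m]) L)%:R * z ^+ r.
Proof.
move=> m_gt0 zm; rewrite horner_sum.
under [RHS]eq_bigr => r _ do rewrite -sum1_count natr_sum mulr_suml big_mkcond.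
rewrite exchange_big; apply: eq_bigr => x _ /=; rewrite hornerXn.
pose r0 := Ordinal (ltn_pmod x m_gt0).
rewrite (bigD1 r0) //= modn_mod eqxx mul1r big1 ?addr0 ?expr_mod //.
move=> r; rewrite -val_eqE /= eq_sym (modn_small (ltn_ord r)).
by move/negbTE->.
Qed.

(** Equal counts factor out of a vanishing geometric sum. Conversely, the counts minus the last one
    are the coefficients of a polynomial with more roots than its degree allows. *)
Lemma equidistributed_roots (L : seq nat) (m : nat) : (0 < m)%N -> uniq L ->
  equidistributed [set` L] m <->
  forall z : algC, z ^+ m = 1 -> z <> 1 -> (gen_poly L).[z] = 0.
Proof.
move=> m_gt0 uL; rewrite equidistributed_seqP //.
pose c i := count (fun x => x == i %[mod m]) L.
split=> [H z zm z1|H].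
  rewrite (gen_poly_residues _ m) //.
  under eq_bigr => r _ do rewrite (H r 0%N).
  rewrite -mulr_sumr; apply/eqP; rewrite mulf_eq0; apply/orP; right.
  have : (z - 1) * \sum_(r < m) z ^+ r = 0 by rewrite -subrX1 zm subrr.
  by move/eqP; rewrite mulf_eq0 subr_eq0 => /orP[/eqP|].
have [z pz] := C_prim_root_exists m_gt0.
(* Subtracting the count of the class m - 1 kills the top coefficient, so m - 1 coefficients face
   the m - 1 roots z, ..., z^(m-1). *)
pose c0 := c m.-1.
pose g : {poly algC} := \poly_(i < m.-1) ((c i)%:R - c0%:R).
have g0 : g = 0.
  apply: (@roots_geq_poly_eq0 _ _ [seq z ^+ i | i <- iota 1 m.-1]).
  - apply/allP => _ /mapP[i + ->]; rewrite mem_iota => i_bd.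
    have wm : (z ^+ i) ^+ m = 1 by rewrite exprAC (prim_expr_order pz) expr1n.
    have w1 : z ^+ i <> 1.
      move/eqP; rewrite -(prim_order_dvd pz) => /dvdn_leq; lia.
    have Hw := H _ wm w1; rewrite (gen_poly_residues _ m) // in Hw.
    have Sw : \sum_(r < m) (z ^+ i) ^+ r = 0.
      have : (z ^+ i - 1) * \sum_(r < m) (z ^+ i) ^+ r = 0 by rewrite -subrX1 wm subrr.
      by move/eqP; rewrite mulf_eq0 subr_eq0 => /orP[/eqP|/eqP].
    rewrite rootE horner_poly.
    have : \sum_(r < m) ((c r)%:R - c0%:R) * (z ^+ i) ^+ r = 0 :> algC.
      under eq_bigr => r _ do rewrite mulrBl.
      by rewrite sumrB Hw -mulr_sumr Sw mulr0 subrr.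
    rewrite -(big_mkord xpredT (fun r => ((c r)%:R - c0%:R) * (z ^+ i) ^+ r)).
    rewrite -[in index_iota _ _](prednK m_gt0) big_nat_recr //= subrr mul0r addr0.
    by rewrite big_mkord => ->.
  - rewrite map_inj_in_uniq ?iota_uniq // => i j; rewrite !mem_iota => ib jb.
    move/eqP; rewrite (eq_prim_root_expr pz) !modn_small; [by move/eqP|lia|lia].
  - by rewrite size_map size_iota size_poly.
have cE i : (i < m)%N -> c i = c0.
  move=> i_lt; have [->//|i_neq] := eqVneq i m.-1.
  have := coef_poly m.-1 (fun i => (c i)%:R - c0%:R : algC) i.
  rewrite -/g g0 coef0; have -> : (i < m.-1)%N by lia.
  by move/esym/eqP; rewrite subr_eq0 eqr_nat => /eqP.
have cM i : c i = c (i %% m)%N.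
  by apply: eq_count => x /=; rewrite modn_mod.
by move=> i j; rewrite -/(c i) -/(c j) cM (cM j) !cE // ltn_pmod.
Qed.
End GeneratingPolynomial.

(** * Minimal generating sets and the standard presentation *)

Section Semigroups.
Local Open Scope classical_set_scope.

(** Repetition in a list replaces coefficients, which allows induction on the list. *)
Lemma generatedP (G : set nat) (n : nat) :
  generated G n <-> exists2 t : seq nat, [set` t] `<=` G & n = sumn t.
Proof.
split=> [[s [c [sG ->]]]|[t tG ->]].
  exists (flatten [seq nseq (c x) x | x <- s]).
    move=> y /= /flattenP[_ /mapP[x xs ->]]; rewrite mem_nseq => /andP[_ /eqP->].
    exact: sG.
  rewrite sumn_flatten -map_comp sumnE big_map; apply: eq_bigr => x _ /=.
  by rewrite sumn_nseq mulnC.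
exists t, (fun=> 1); split=> //.
by rewrite sumnE; apply: eq_bigr => x _; rewrite mul1n.
Qed.

Lemma generated_mem (G : set nat) (x : nat) : G x -> generated G x.
Proof.
move=> Gx; apply/generatedP; exists [:: x]; last by rewrite /= addn0.
by move=> y /=; rewrite inE => /eqP->.
Qed.

Lemma generatedD (G : set nat) (x y : nat) :
  generated G x -> generated G y -> generated G (x + y).
Proof.
move=> /generatedP[s sG ->] /generatedP[t tG ->]; apply/generatedP.
exists (s ++ t); last by rewrite sumn_cat.
by move=> z /=; rewrite mem_cat => /orP[/sG|/tG].
Qed.

(** The irreducible elements, used to show that a minimal generating set is unique. *)
Definition atoms (S : set nat) : set nat :=
  [set x | [/\ S x, 0 < x &
    forall y z, S y -> S z -> x = y + z -> y = 0 \/ z = 0]].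

(** Splitting off the first summand of an atom leaves either the atom itself or 0. *)
Lemma atoms_sub_generators (G : set nat) : atoms (generated G) `<=` G.
Proof.
move=> x [/generatedP[t tG xE] x_gt0 x_irr].
elim: t x tG xE x_gt0 x_irr => [|y t IH] x tG xE x_gt0 x_irr.
  by rewrite xE in x_gt0.
have tG' : [set` t] `<=` G by move=> z zt; apply: tG => /=; rewrite inE zt orbT.
have Gy : G y by apply: tG; rewrite /= inE eqxx.
have St : generated G (sumn t) by apply/generatedP; exists t.
case: (x_irr y (sumn t) (generated_mem _ _ Gy) St xE) => [y0|t0].
  by apply: IH => //; rewrite xE /= y0.
by rewrite xE /= t0 addn0.
Qed.

(** Strong induction: a positive element that is not an atom is a sum of two smaller positive
    elements. *)
Lemma generated_atoms (S : set nat) :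
  S 0 -> (forall x y, S x -> S y -> S (x + y)) -> generated (atoms S) = S.
Proof.
move=> S0 SD; apply/seteqP; split=> x.
  case/generatedP=> t tA ->; elim: t tA => [|y t IH] //= tA.
  apply: SD; first by case: (tA y) => //=; rewrite inE eqxx.
  by apply: IH => z /= zt; apply: tA => /=; rewrite inE zt orbT.
elim/ltn_ind: x => x IH Sx.
have [->|x_gt0] := posnP x; first by apply/generatedP; exists [::].
have [[y [z [Sy Sz xE y_gt0 z_gt0]]]|x_irr] :=
    pselect (exists y z, [/\ S y, S z, x = y + z, 0 < y & 0 < z]).
  by rewrite xE; apply: generatedD; apply: IH => //; lia.
apply: generated_mem; split=> // y z Sy Sz xE.
have [|y_gt0] := posnP y; first by left.
have [|z_gt0] := posnP z; first by right.
by case: x_irr; exists y, z.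
Qed.

Lemma minimal_generating_set_atoms (S G : set nat) : numerical_semigroup S ->
  minimal_generating_set S G -> G = atoms S.
Proof.
case=> S0 SD _ [GS Gmin]; apply/esym/Gmin; last exact: generated_atoms.
by rewrite -GS; exact: atoms_sub_generators.
Qed.

Lemma generated_dvd (G : set nat) (g n : nat) :
  (forall x, G x -> g %| x) -> generated G n -> g %| n.
Proof.
move=> gG /generatedP[t tG ->]; elim: t tG => [|y t IH] //= tG.
apply: dvdn_add; first by apply/gG/tG; rewrite /= inE eqxx.
by apply: IH => z /= zt; apply: tG => /=; rewrite inE zt orbT.
Qed.

Lemma generated_lower_bound (G : set nat) (a n : nat) :
  (forall x, G x -> a <= x) -> generated G n -> 0 < n -> a <= n.
Proof.
move=> aG /generatedP[[|y t] tG ->] //= _.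
apply: leq_trans (leq_addr _ _); apply: aG; apply: tG; by rewrite /= inE eqxx.
Qed.

(** A cofinite set contains two consecutive integers. *)
Lemma cofinite_dvd (S : set nat) (g : nat) :
  finite_set (~` S) -> (forall n, S n -> g %| n) -> g = 1.
Proof.
move=> fS gS.
have [N SN] : exists N, forall n, N <= n -> S n.
  have /finite_seqP[s sE] := fS.
  (* No gap exceeds the sum of all gaps. *)
  exists (sumn s).+1 => n n_gt; apply: contrapT => nS.
  have ns : n \in s by have : (~` S) n by []; rewrite sE.
  suff : n <= sumn s by lia.
  rewrite sumnE (big_rem _ ns) /=; lia.
have /gS g1 : S N by exact: SN.
have /gS : S N.+1 by apply: SN.
by rewrite -addn1 (dvdn_addr _ g1) dvdn1 => /eqP.
Qed.

(** By uniqueness of the minimal generating set, the embedding dimension is k + 1; the multiplicity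
    is the first term a, so k = a - 1. Since gcd(a, d) divides all of S, it is 1. *)
Lemma standard_presentation_exists (S : set nat) :
  numerical_semigroup S -> maximal_embedding_dimension S ->
  generated_by_arithmetic_sequence S -> exists a d, standard_presentation S a d.
Proof.
move=> hS [e [Se e_gt0 e_min] [G' minG' cardG']] [a [d [k [d_gt0 minG]]]].
have [S0 SD Sfin] := hS.
have GA := minimal_generating_set_atoms _ _ hS minG.
rewrite (minimal_generating_set_atoms _ _ hS minG') -GA in cardG'.
have GS := minG.1.
have Ga : arithmetic_sequence a d k a by exists 0; rewrite ?mul0n ?addn0.
have a_gt0 : 0 < a by move: Ga; rewrite GA => -[].
have ea : e = a.
  apply/eqP; rewrite eqn_leq; apply/andP; split.
    by apply: e_min => //; rewrite -GS; exact: generated_mem.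
  apply: (@generated_lower_bound (arithmetic_sequence a d k)); rewrite ?GS //.
  by move=> _ [i _ <-]; exact: leq_addr.
have ka : k = a.-1.
  suff -> : a = k.+1 by [].
  rewrite -ea; apply/esym/(@card_eq_II _ _).
  rewrite -(card_eqr cardG'); apply/card_set_bijP.
  exists (fun i => a + i * d); split.
  - by move=> i /= ik; exists i.
  - by move=> i j _ _ /=; nia.
  - by move=> _ [i ik <-]; exists i.
have cop : coprime a d.
  apply/eqP/(cofinite_dvd _ _ Sfin) => n; rewrite -GS; apply: generated_dvd.
  by move=> _ [i _ <-]; rewrite dvdn_add ?dvdn_gcdl // dvdn_mull // dvdn_gcdr.
(* For a = 1 the sequence has a single term, and d can be reset to 1. *)
have [a1|a_neq1] := eqVneq a 1.
  exists 1, 1; split=> //; rewrite -GS ka a1; congr generated.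
  by apply/seteqP; split=> _ [i /= i0 <-]; exists 0 => //; lia.
by exists a, d; split=> //; [rewrite -ka GS | move/eqP: a_neq1].
Qed.
End Semigroups.

(** * The gaps and their generating polynomial *)

Section Gaps.
Local Open Scope classical_set_scope.
Variables a d : nat.
Hypotheses (a_gt0 : 0 < a) (d_gt0 : 0 < d) (cop : coprime a d).

(** A sum of s > 0 generators is s a + I d, and reducing I modulo a changes I d by a multiple of a.
    So the positive elements in the class of i d start at a + i d. *)
Lemma mem_arithmetic_semigroup (n : nat) :
  generated (arithmetic_sequence a d a.-1) n <->
  n = 0 \/ exists2 i, i < a & a + i * d <= n /\ n = i * d %[mod a].
Proof.
rewrite generatedP; split=> [[t tG ->]|].
  case: t tG => [|y t] tG; [by left | right].
  have [I E] : exists I, sumn (y :: t) = (size t).+1 * a + I * d.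
    elim: t y tG => [|x t IH] y tG.
      have [|i _ <-] := tG y; first by rewrite /= inE.
      by exists i; rewrite /= mul1n addn0.
    have [|i _ yE] := tG y; first by rewrite /= inE eqxx.
    have [|I E] := IH x; first by move=> z /= zt; apply: tG => /=; rewrite inE zt orbT.
    exists (i + I); have -> : sumn [:: y, x & t] = y + sumn (x :: t) by [].
    rewrite E -yE /=; lia.
  exists (I %% a); first exact: ltn_pmod.
  rewrite E; split; first by have := leq_mod I a; nia.
  by rewrite modnMDl modnMml.
case=> [->|[i i_lt [le_n /eqP E]]]; first by exists [::].
have n_id : i * d <= n by lia.
rewrite eqn_mod_dvd // in E; have /dvdnP[q nE] := E.
have q_gt0 : 0 < q by case: q nE => // ; lia.
(* Here n - i d = q a; one of the q copies of a is absorbed in a + i d. *)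
exists (a + i * d :: nseq q.-1 a); last by rewrite /= sumn_nseq; nia.
move=> x /=; rewrite inE mem_nseq => /orP[/eqP->|/andP[_ /eqP->]].
  by exists i => //=; lia.
by exists 0; rewrite ?mul0n ?addn0.
Qed.

Lemma coprime_mod_inj (i j : nat) :
  i < a -> j < a -> i * d = j * d %[mod a] -> i = j.
Proof.
wlog ij : i j / i <= j.
  move=> W ia ja E; case: (leqP i j) => ij; first exact: W.
  by apply/esym/W => //; exact: ltnW.
move=> ia ja /esym/eqP; rewrite eqn_mod_dvd ?leq_mul2r ?ij ?orbT // -mulnBl.
rewrite Gauss_dvdl //; case: (posnP (j - i)) => [|ji /(dvdn_leq ji)]; lia.
Qed.

Lemma coprime_mod_surj (n : nat) : exists2 i, i < a & n = i * d %[mod a].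
Proof.
case: (egcdnP a d_gt0) => u v E _.
rewrite (gcdnC d) (eqP cop) in E.
(* u is an inverse of d modulo a. *)
exists ((n * u) %% a); first exact: ltn_pmod.
rewrite modnMml -mulnA E mulnDr muln1 addnC mulnA -modnDmr modnMl addn0 //.
Qed.

(** The gaps in the class of i d run in steps of a from the remainder of i d up to i d itself. The
    class i = 0 has none. *)
Definition gap_seq : seq nat :=
  [seq (i * d) %% a + a * j | i <- iota 1 a.-1, j <- iota 0 ((i * d) %/ a).+1].

Lemma gap_seq_uniq : uniq gap_seq.
Proof.
apply: allpairs_uniq_dep; first exact: iota_uniq.
  by move=> i _; exact: iota_uniq.
move=> [i j] [i' j'] /allpairsPdep[i0 [j0 [i0_in _ [-> ->]]]].
move=> /allpairsPdep[i1 [j1 [i1_in _ [-> ->]]]] /= E.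
rewrite !mem_iota in i0_in i1_in.
have Ei : i0 = i1.
  apply: coprime_mod_inj; [lia | lia |].
  have := congr1 (modn^~ a) E.
  by rewrite /= !(addnC _ (a * _)) !(mulnC a) !modnMDl !modn_mod.
by move: E; rewrite Ei => /addnI/eqP; rewrite eqn_pmul2l // => /eqP->.
Qed.

Lemma gaps_arithmetic :
  gaps (generated (arithmetic_sequence a d a.-1)) = [set` gap_seq].
Proof.
rewrite /gaps; apply/seteqP; split=> n /=; rewrite mem_arithmetic_semigroup.
  move=> ngen.
  have n_gt0 : 0 < n by case: (posnP n) => // n0; case: ngen; left.
  have [i i_lt E] := coprime_mod_surj n.
  have n_lt : n < a + i * d.
    by case: ltnP => // le_n; case: ngen; right; exists i.
  have i_gt0 : 0 < i.
    case: (posnP i) E n_lt => // ->; rewrite mul0n mod0n addn0 => + n_lt.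
    by rewrite modn_small //; lia.
  apply/allpairsPdep; exists i, (n %/ a); split.
  - rewrite mem_iota; lia.
  - rewrite mem_iota /= add0n -(ltn_pmul2r a_gt0) mulSn.
    have := divn_eq (i * d) a; have := divn_eq n a; rewrite E; lia.
  - by rewrite -E mulnC addnC -divn_eq.
case/allpairsPdep=> i [j [+ +]]; rewrite !mem_iota => i_bd j_bd nE.
have nmod : n = i * d %[mod a] by rewrite nE addnC mulnC modnMDl modn_mod.
case=> [n0|[i' i'_lt [le_n E]]].
  suff : i = 0 by lia.
  apply: coprime_mod_inj; [lia | lia |].
  by rewrite -nmod n0 mul0n.
have ii' : i = i' by apply: coprime_mod_inj; [lia | lia | rewrite -nmod].
rewrite -ii' in le_n.
have := divn_eq (i * d) a; nia.
Qed.

Import GRing.Theory.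
Local Open Scope ring_scope.

(** The factor X^a - 1 telescopes each class to X^(a + i d) minus X to the remainder of i d. The
    factors X^d - 1 and X - 1 then sum the two resulting geometric series. *)
Lemma gap_poly_mul :
  ('X - 1) * ('X^a - 1) * ('X^d - 1) * gen_poly gap_seq = six_terms a d.
Proof.
have EH : ('X^a - 1) * gen_poly gap_seq =
   \sum_(i <- iota 1 a.-1) 'X^(a + i * d) - \sum_(i <- iota 1 a.-1) 'X^i.
  (* As d is invertible modulo a, taking i to the remainder of i d permutes 1, ..., a - 1. *)
  have -> : \sum_(i <- iota 1 a.-1) 'X^i
          = \sum_(i <- iota 1 a.-1) 'X^((i * d) %% a) :> {poly algC}.
    rewrite -(big_map (fun i => (i * d) %% a)%N xpredT (fun i => 'X^i)).
    apply: perm_big; rewrite perm_sym; apply: uniq_perm; rewrite ?iota_uniq //.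
      rewrite map_inj_in_uniq ?iota_uniq // => i j; rewrite !mem_iota => ib jb.
      by apply: coprime_mod_inj; lia.
    move=> r; apply/mapP/idP => [[i + ->]|].
      rewrite !mem_iota => ib.
      have := ltn_pmod (i * d) a_gt0.
      have [r0|] := posnP ((i * d) %% a)%N; last lia.
      have : i = 0%N by apply: coprime_mod_inj; rewrite ?mul0n ?mod0n //; lia.
      lia.
    rewrite mem_iota => rb; have [i i_lt E] := coprime_mod_surj r.
    exists i; last by rewrite -E modn_small //; lia.
    rewrite mem_iota; case: (posnP i) E => [->|]; last lia.
    by rewrite mul0n mod0n modn_small; lia.
  rewrite -sumrB /gen_poly big_allpairs_dep mulr_sumr.
  apply: eq_bigr => i _.
  have -> : \sum_(j <- iota 0 ((i * d) %/ a).+1) 'X^((i * d) %% a + a * j)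
    = 'X^((i * d) %% a) * \sum_(j < ((i * d) %/ a).+1) 'X^a ^+ j :> {poly algC}.
    rewrite -[iota _ _]/(index_iota 0 ((i * d) %/ a).+1) big_mkord mulr_sumr.
    by apply: eq_bigr => j _; rewrite exprD exprM.
  rewrite mulrCA -subrX1 mulrBr mulr1 -exprM -exprD; congr ('X^_ - _).
  rewrite mulnS [in RHS](divn_eq (i * d) a); lia.
have E1 : ('X^d - 1) * \sum_(i <- iota 1 a.-1) 'X^(a + i * d)
    = 'X^(a + a * d) - 'X^(a + d) :> {poly algC}.
  have -> : iota 1 a.-1 = index_iota 1 a by rewrite /index_iota subn1.
  rewrite big_add1 big_mkord.
  have -> : \sum_(i < a.-1) 'X^(a + i.+1 * d)
     = 'X^(a + d) * \sum_(i < a.-1) 'X^d ^+ i :> {poly algC}.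
    rewrite mulr_sumr; apply: eq_bigr => i _; rewrite -exprM -exprD; congr ('X^_); lia.
  rewrite mulrCA -subrX1 mulrBr mulr1 -exprM -exprD; congr ('X^_ - _); nia.
have E2 : ('X - 1) * \sum_(i <- iota 1 a.-1) 'X^i = 'X^a - 'X :> {poly algC}.
  have -> : iota 1 a.-1 = index_iota 1 a by rewrite /index_iota subn1.
  rewrite big_add1 big_mkord.
  have -> : \sum_(i < a.-1) 'X^(i.+1) = 'X * \sum_(i < a.-1) 'X ^+ i :> {poly algC}.
    by rewrite mulr_sumr; apply: eq_bigr => i _; rewrite exprS.
  by rewrite mulrCA -subrX1 mulrBr mulr1 -exprS prednK.
transitivity (('X - 1) * ('X^d - 1) * (('X^a - 1) * gen_poly gap_seq)); first ring.
rewrite EH mulrBr.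
transitivity (('X - 1) * (('X^d - 1) * \sum_(i <- iota 1 a.-1) 'X^(a + i * d))
  - ('X^d - 1) * (('X - 1) * \sum_(i <- iota 1 a.-1) 'X^i) : {poly algC}); first ring.
rewrite E1 E2 /six_terms !exprD !expr1 ; ring.
Qed.
End Gaps.

(** * The arithmetic criterion *)

Section Criterion.
Import GRing.Theory.
Local Open Scope ring_scope.
Local Open Scope nat_scope.

(** The final congruences are over the integers because of -1; the proof works with naturals. *)
Lemma eqz_mod1 (a m : nat) :
  (a%:Z = 1 %[mod m%:Z])%Z <-> a = 1 %[mod m].
Proof.
by rewrite -[1%R]/(1%:Z) !modz_nat; split=> [[]|->].
Qed.

Lemma eqz_modN1 (d m : nat) :
  (d%:Z = -1 %[mod m%:Z])%Z <-> m %| d.+1.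
Proof.
have -> : (m %| d.+1) = (d%:Z == -1 %[mod m%:Z])%Z.
  by rewrite eqz_mod_dvd opprK -[1%R]/(1%:Z) -PoszD addn1.
by split=> /eqP.
Qed.

Lemma six_terms_primitive (a d m : nat) (z : algC) :
  0 < a -> coprime (a * d) m -> m.-primitive_root%R z ->
  ((six_terms a d).[z] = 0)%R -> a = 1 %[mod m] \/ m %| d.+1.
Proof.
move=> a_gt0; rewrite coprimeMl => /andP[cam cdm] pz.
rewrite six_terms_eval => E.
have m_gt0 := prim_order_gt0 pz.
have zm := prim_expr_order pz.
have U i : ((z ^+ i) * (z ^+ i)^* = 1)%R.
  by apply: (root_unity_conj m) => //; rewrite exprAC zm expr1n.
have z0 : (z != 0)%R.
  by apply: contra_eq_neq zm => ->; rewrite expr0n gtn_eqF // eq_sym oner_eq0.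
(* P(z) = 0 is divided by z, and the term 1 is written z^0. *)
have : [\/ (z ^+ (a * d + a) = z ^+ (a * d + a.-1))%R,
  (z ^+ (a * d + a) = z ^+ (a + d))%R | (z ^+ (a * d + a) = z ^+ 0)%R].
  apply: (@unimodular_triples _ (z ^+ a.-1) (z ^+ d) _ _ _)%R; rewrite ?U //.
    apply: (mulIf z0); apply/eqP; rewrite -subr_eq0; apply/eqP.
    have za : (z ^+ a = z * z ^+ a.-1)%R by rewrite -exprS prednK.
    by rewrite -[RHS]E !exprD za expr0 expr1; ring.
  by rewrite -!exprD; congr (_ ^+ _)%R; lia.
(* The cases say that m divides 1, (a - 1) d and a (d + 1); coprimality removes d and a. *)
case=> /eqP; rewrite (eq_prim_root_expr pz).
- have -> : a * d + a = a * d + a.-1 + 1 by lia.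
  rewrite -[X in _ == X %[mod m]]addn0 eqn_modDl mod0n => m1; left; apply/eqP.
  have /eqP -> : m == 1 by rewrite -dvdn1.
  by rewrite !modn1.
- have -> : a * d + a = a + d + a.-1 * d by nia.
  rewrite -[X in _ == X %[mod m]]addn0 eqn_modDl mod0n.
  rewrite -/(dvdn _ _) Gauss_dvdl 1?coprime_sym // => m_dvd; left; apply/eqP.
  by rewrite eqn_mod_dvd // subn1.
- rewrite mod0n -/(dvdn _ _) -mulnSr Gauss_dvdr 1?coprime_sym // => ?; by right.
Qed.

(** Either z^a = z and z^(ad) = z^d, or z^(d+1) = z^(ad+a) = 1; both make the six terms cancel. *)
Lemma six_terms_vanish (a d m : nat) (z : algC) :
  (z ^+ m = 1)%R -> a = 1 %[mod m] \/ m %| d.+1 -> ((six_terms a d).[z] = 0)%R.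
Proof.
move=> zm; rewrite six_terms_eval !exprD expr1 => -[a1|/dvdnP[q dE]].
  have za : (z ^+ a = z)%R by rewrite -(expr_mod _ zm) a1 expr_mod.
  rewrite exprM za; ring.
have zd : (z ^+ d * z = 1)%R by rewrite -exprSr dE mulnC exprM zm expr1n.
have zad : (z ^+ (a * d) * z ^+ a = 1)%R.
  by rewrite mulnC exprM -exprMn zd expr1n.
by rewrite zad -mulrA zd; ring.
Qed.

(** The order of z divides both k and m. *)
Lemma root_unity_coprime_eq1 (k m : nat) (z : algC) :
  0 < m -> coprime k m -> (z ^+ k = 1)%R -> (z ^+ m = 1)%R -> z = 1%R.
Proof.
move=> m_gt0 ckm zk zm; have [n n_prim /dvdnP[q mE]] := prim_order_exists m_gt0 zm.
have nk : n %| k by rewrite (prim_order_dvd n_prim) zk.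
have nm : n %| m by rewrite mE dvdn_mull.
have : n %| 1 by rewrite -(eqP ckm) dvdn_gcd nk.
by rewrite (prim_order_dvd n_prim) expr1 => /eqP.
Qed.

Lemma equidistributed_gaps_arithmetic (a d m : nat) :
  0 < m -> 0 < a -> 0 < d -> coprime a d -> (a = 1 -> d = 1) ->
  equidistributed (gaps (generated (arithmetic_sequence a d a.-1))) m <->
  coprime (a * d) m /\ (a = 1 %[mod m] \/ m %| d.+1).
Proof.
move=> m_gt0 a_gt0 d_gt0 cad ad1.
rewrite gaps_arithmetic // equidistributed_roots ?gap_seq_uniq //.
have HE := gap_poly_mul a d a_gt0 d_gt0 cad.
have [z pz] := C_prim_root_exists m_gt0.
split=> [H|[cop C] w wm w1]; last first.
  (* P(w) = 0, while by coprimality none of the three binomials vanishes at w, so H(w) = 0. *)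
  have := congr1 (fun p : {poly algC} => p.[w])%R HE.
  rewrite (six_terms_vanish a d m) // !hornerE => /eqP; rewrite !mulf_eq0 !subr_eq0.
  move: cop; rewrite coprimeMl => /andP[cam cdm].
  case/orP=> [/orP[/orP[]|]|] /eqP // wk; case: w1.
    exact: (root_unity_coprime_eq1 a m).
  exact: (root_unity_coprime_eq1 d m).
have no_root (w : algC) : (w ^+ m = 1 -> (w ^+ a == 1) || (w ^+ d == 1) -> w = 1)%R.
  move=> wm wad; have [//|/eqP w1] := eqVneq w 1%R.
  exact: (six_terms_no_root a d m w _ m_gt0 a_gt0 d_gt0 ad1 HE wm (H w wm w1) wad).
(* A root of unity of order gcd(k, m) is both a k-th and an m-th root of unity. *)
have gcd1 k : (forall w : algC, (w ^+ m = 1 -> w ^+ k = 1 -> w = 1)%R) -> coprime k m.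
  move=> K; apply/eqP/nth_root_primitive_trivial; first by rewrite gcdn_gt0 m_gt0 orbT.
  move=> w wg; apply: K.
    by have /dvdnP[q ->] := dvdn_gcdr k m; rewrite mulnC exprM wg expr1n.
  by have /dvdnP[q ->] := dvdn_gcdl k m; rewrite mulnC exprM wg expr1n.
have cop : coprime (a * d) m.
  rewrite coprimeMl !gcd1 // => w wm /eqP wk; apply: no_root => //; rewrite wk ?orbT //.
split=> //; apply: (six_terms_primitive a d m z) => //.
(* z = 1 occurs for m = 1; there the factor X - 1 makes P vanish. *)
rewrite -HE !hornerE; have [z1|/eqP z1] := eqVneq z 1%R.
  by rewrite z1 subrr !mul0r.
by rewrite (H z (prim_expr_order pz) z1) mulr0.
Qed.
End Criterion.

Theorem corollary5p10 (S : set nat) (m : nat)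
    (hS : numerical_semigroup S)
    (hmed : maximal_embedding_dimension S)
    (harith : generated_by_arithmetic_sequence S)
    (hm : 0 < m) :
  (exists a d : nat, standard_presentation S a d) /\
  (forall a d : nat, standard_presentation S a d ->
     (equidistributed (gaps S) m <->
      gcdn (a * d) m = 1 /\
      ((a%:Z = 1 %[mod m%:Z])%Z \/ (d%:Z = -1 %[mod m%:Z])%Z))).
Proof.
split; first exact: standard_presentation_exists.
move=> a d [a_gt0 d_gt0 cad -> ad1].
rewrite equidistributed_gaps_arithmetic // eqz_mod1 eqz_modN1.
by split=> -[/eqP ? ?]; split=> //; apply/eqP.
Qed.
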